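(* Let $f:[a,b]\to\mathbb{R}$ be $g$-continuous on $[a,b]$. Then $f'_g(t)=0$ for all $t\in[a,b]$ (in particular $f$ is $g$-differentiable on $[a,b]$) if and only if $f$ is constant on $[a,b]$.
   Context: Let $a<b$ be real numbers and let $g:\mathbb{R}\to\mathbb{R}$ be non-decreasing and left-continuous (a ''derivator''). Put $\Delta g(t)=g(t^+)-g(t)$, $D_g=\{t\in\mathbb{R}:\Delta g(t)>0\}$, and $C_g=\{t\in\mathbb{R}: g \text{ is constant on } (t-\varepsilon,t+\varepsilon)\text{ for some }\varepsilon>0\}$. The set $C_g$ is open; write $C_g=\bigcup_n (a_n,b_n)$ with $(a_n,b_n)$ its (pairwise disjoint) connected components. Put $N_g^-=\{a_n\}_n\setminus D_g$, $N_g^+=\{b_n\}_n\setminus D_g$. Standing assumption: $a\notin N_g^-$ and $b\notin N_g^+\cup D_g\cup C_g$. $g$-derivative: for $f:[a,b]\to\mathbb{R}$ and $t\in[a,b]$, $f'_g(t)=\lim_{s\to t}\frac{f(s)-f(t)}{g(s)-g(t)}$ if $t\notin D_g\cup C_g$; $f'_g(t)=\lim_{s\to t^+}\frac{f(s)-f(t)}{g(s)-g(t)}$ if $t\in D_g$; $f'_g(t)=\lim_{s\to b_n^+}\frac{f(s)-f(b_n)}{g(s)-g(b_n)}$ if $t\in(a_n,b_n)\subset C_g$; provided the limit exists (and is finite). Limits are taken over those $s\in[a,b]$ for which the denominator is nonzero. $f$ is $g$-differentiable on $[a,b]$ if $f'_g(t)$ exists for every $t\in[a,b]$. $g$-continuity: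 $f$ is $g$-continuous at $t\in[a,b]$ if for every $\varepsilon>0$ there is $\delta>0$ such that $|f(t)-f(s)|<\varepsilon$ for all $s\in[a,b]$ with $|g(t)-g(s)|<\delta$; $g$-continuous on $[a,b]$ means at every point of $[a,b]$. *)

(* Defs.v *)
From mathcomp Require Import all_boot all_order all_algebra.
From mathcomp Require Import all_classical all_reals all_analysis.

Set Implicit Arguments.
Unset Strict Implicit.
Unset Printing Implicit Defensive.

Import Order.TTheory GRing.Theory Num.Theory.
Import numFieldNormedType.Exports.

Local Open Scope classical_set_scope.
Local Open Scope ring_scope.

Section Derivator.
Context {R : realType}.
Implicit Types (g f : R -> R) (a b t l : R) (u v : \bar R).

Definition derivator g :=
  {homo g : x y / x <= y} /\ forall t, g s @[s --> t^'-] --> g t.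

Definition jump g t : R := lim (g s @[s --> t^'+]) - g t.

Definition Dset g : set R := [set t | 0 < jump g t].

Definition Cset g : set R :=
  [set t | exists2 e : R, 0 < e &
     exists c : R, forall s, t - e < s < t + e -> g s = c].

(* The endpoints are extended reals because a component of the open set
   [Cset g] may be unbounded. *)
Definition Ccomponent g u v :=
  exists2 t, Cset g t &
    connected_component (Cset g) t = [set s : R | (u < s%:E < v)%E].

Definition Nminus g : set R :=
  [set x | exists v, Ccomponent g x%:E v] `\` Dset g.

Definition Nplus g : set R :=
  [set y | exists u, Ccomponent g u y%:E] `\` Dset g.

(* The points [s] allowed in the limit that defines the derivative. *)
Definition gadm a b g t : set R := [set s | a <= s <= b /\ g s != g t].

Definition gquot g f t (s : R) : R := (f s - f t) / (g s - g t).

(* [has_gderiv a b g f t l] means that the g-derivative at [t] of the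
   restriction of [f] to [[a, b]] exists and equals [l].  If [t] is in [Cset g],
   the limit is taken at the right endpoint [y] of the component of [t]. *)
Definition has_gderiv a b g f t l :=
  [\/ [/\ ~ Dset g t, ~ Cset g t &
        gquot g f t @ within (gadm a b g t) (nbhs t) --> l],
      Dset g t /\ gquot g f t @ within (gadm a b g t) t^'+ --> l |
      exists u (y : R), [/\ Ccomponent g u y%:E, (u < t%:E < y%:E)%E &
        gquot g f y @ within (gadm a b g y) y^'+ --> l]].

Definition gcontinuous a b g f :=
  forall t, a <= t <= b -> forall e : R, 0 < e ->
    exists2 d : R, 0 < d &
      forall s, a <= s <= b -> `|g t - g s| < d -> `|f t - f s| < e.

End Derivator.

(* Main.v *)
Require Import Defs.
From mathcomp Require Import all_boot all_order all_algebra.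
From mathcomp Require Import all_classical all_reals all_analysis.
From mathcomp Require Import lra.

(** If [f] is constant, every difference quotient vanishes; the only point left
    is that the g-derivative makes sense at a point [t] of [Cset g], which needs
    the component of [t] to have a finite right endpoint.  It does because [b]
    lies to the right of [t] and outside [Cset g]
    ([Ccomponent_right_endpoint]).

    Conversely, suppose that the g-derivative vanishes on [[a, b]] and fix
    [e > 0].  As in the classical proof of the mean value inequality, one shows
    [`|f t - f a| <= e * (g t - g a)] for all [t] in [[a, b]] by letting [t]
    creep from [a] to [b] ([segment_ind]) and then lets [e] tend to [0].  The
    inequality passes to the limit from the left, because [g] is left-continuous
    and a g-continuous function inherits this ([gcontinuous_cvg_left]).  It
    extends a little to the right of [t] ([gderiv0_right_increment]): at the
    points [s] near [t] with [g s != g t] the vanishing derivative bounds the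
    increment of [f] by [e * (g s - g t)], and at those with [g s = g t], where
    the derivative says nothing, g-continuity forces [f s = f t].  The latter
    also disposes of the points of [Cset g], where the derivative is taken at
    another point. *)

Set Implicit Arguments.
Unset Strict Implicit.
Unset Printing Implicit Defensive.

Import Order.TTheory GRing.Theory Num.Theory.
Import numFieldNormedType.Exports.

Local Open Scope classical_set_scope.
Local Open Scope ring_scope.

(** Induction along a segment: otherwise the supremum of the [t] such that [P]
    holds on all of [[a, t]] satisfies [P] by the first step, and the second
    step pushes [P] beyond it. *)
Lemma segment_ind (R : realType) (a b : R) (P : R -> Prop) :
    P a ->
    (forall t, a < t <= b -> (forall s, a <= s < t -> P s) -> P t) ->
    (forall t, a <= t < b -> P t -> \forall s \near t^'+, P s) ->
  forall t, a <= t <= b -> P t.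
Proof.
move=> Pa Pleft Pright t /andP[at_ tb].
pose S := [set x | a <= x <= b /\ forall s, a <= s <= x -> P s].
have ab : a <= b by lra.
have Sa : S a.
  by split=> [|s sa]; [lra | have -> : s = a by lra].
have ubS : ubound S b by move=> x [+ _]; lra.
have supS : has_sup S by split; [exists a | exists b].
have aS : a <= sup S by apply: ub_le_sup => //; exists b.
have Sb : sup S <= b by apply: ge_sup => //; exists a.
have below s : a <= s < sup S -> P s.
  move=> /andP[as_ sS].
  have [x [_ Px] sx] : exists2 x, S x & s < x by apply: sup_gt => //; exists a.
  by apply: Px; lra.
have PS : P (sup S).
  have [<-//|aneqS] := eqVneq a (sup S).
  by apply: Pleft => //; rewrite lt_neqAle aneqS aS.
have [Slt|] := ltP (sup S) b; last first.
  move=> bS; have [tS|St] := ltP t (sup S); first by apply: below; lra.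
  by have -> : t = sup S by lra.
have : \forall s \near (sup S)^'+, P s by apply: Pright => //; lra.
rewrite near_withinE => /nbhs_ballP[d /= d0 dP].
pose x := Num.min (sup S + d / 2) b.
have Sx : sup S < x by rewrite /x lt_min; apply/andP; split; lra.
have xb : x <= b by rewrite /x ge_min lexx orbT.
have xd : x <= sup S + d / 2 by rewrite /x ge_min lexx.
suff : x <= sup S by lra.
apply: ub_le_sup; first by exists b.
split=> [|s /andP[as_ sx]]; first by lra.
have [sS|Ss] := ltP s (sup S); first by apply: below; lra.
have [<-//|Sneqs] := eqVneq (sup S) s.
have Slts : sup S < s by rewrite lt_neqAle Sneqs.
by apply: dP => //; rewrite /ball /= distrC ger0_norm; lra.
Qed.

(** Openness excludes the endpoints; a real strictly between them has
    points of [W] on both sides. *)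
Lemma open_interval_endpoints (R : realType) (W : set R) :
    is_interval W -> open W ->
  W = [set s | (ereal_inf (EFin @` W) < s%:E < ereal_sup (EFin @` W))%E].
Proof.
move=> itvW openW; apply/seteqP; split=> [s Ws|s /= /andP[ls su]].
  have /nbhs_ballP[d /= d0 dW] : nbhs s W by exact: open_nbhs_nbhs.
  apply/andP; split.
  - apply: (@le_lt_trans _ _ (s - d / 2)%:E); last by rewrite lte_fin; lra.
    apply: ereal_inf_lbound; exists (s - d / 2) => //.
    by apply: dW; rewrite /ball /= ger0_norm; lra.
  - apply: (@lt_le_trans _ _ (s + d / 2)%:E); first by rewrite lte_fin; lra.
    apply: ereal_sup_ubound; exists (s + d / 2) => //.
    by apply: dW; rewrite /ball /= distrC ger0_norm; lra.
have [_ [x Wx <-]] := ereal_inf_lt ls; rewrite lte_fin => xs.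
have [_ [y Wy <-]] := ereal_sup_gt su; rewrite lte_fin => sy.
by apply: (itvW x y) => //; rewrite !ltW.
Qed.

Section Derivator.
Context {R : realType}.
Implicit Types (g f : R -> R) (a b t : R).

Lemma open_Cset g : open (Cset g).
Proof.
rewrite openE => t [e e0 [c gc]]; apply/nbhs_ballP.
exists (e / 2) => [/=|s]; first by lra.
rewrite /ball /= ltr_norml => ts.
exists (e / 2); first by lra.
by exists c => x sx; apply: gc; lra.
Qed.

(** Around each of its points the component contains a ball of the open set
    [Cset g], balls being connected. *)
Lemma open_Cset_component g t : open (connected_component (Cset g) t).
Proof.
rewrite openE => s Ws.
have Cs : Cset g s := connected_component_sub Ws.
have /nbhs_ballP[d /= d0 dC] : nbhs s (Cset g).
  by apply: open_nbhs_nbhs; split=> //; exact: open_Cset.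
apply/nbhs_ballP; exists d => //= x sx.
rewrite (same_connected_component Ws).
apply: (@connected_component_max _ _ (ball s d)) => //.
- exact: ballxx.
- apply/connected_intervalP => u v; rewrite /ball /= => us vs w uwv.
  by move: us vs; rewrite !ltr_norml; lra.
Qed.

Lemma Ccomponent_right_endpoint g b t :
    Cset g t -> t < b -> ~ Cset g b ->
  exists u (y : R), [/\ Ccomponent g u y%:E, (u < t%:E < y%:E)%E & y <= b].
Proof.
move=> Ct tb nCb; set W := connected_component (Cset g) t.
have Wt : W t by exact: connected_component_refl.
have itvW : is_interval W.
  exact/connected_intervalP/component_connected.
have WE := open_interval_endpoints itvW (@open_Cset_component g t).
have tv : (ereal_inf (EFin @` W) < t%:E < ereal_sup (EFin @` W))%E.
  by move: Wt; rewrite {1}WE.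
have vb : (ereal_sup (EFin @` W) <= b%:E)%E.
  apply: ge_ereal_sup => _ [s Ws <-]; rewrite lee_fin leNgt; apply/negP => bs.
  apply/nCb/(@connected_component_sub _ _ t).
  by apply: (itvW t s) => //; rewrite !ltW.
move: tv vb WE.
case: (ereal_sup _) => [y | | ] tv; rewrite ?lee_fin //; last first.
  by move: tv => /andP[_]; rewrite ltNge leNye.
by move=> yb WE; exists (ereal_inf (EFin @` W)), y; split => //; exists t.
Qed.

Lemma gcontinuous_eq a b g f s t : gcontinuous a b g f ->
  a <= s <= b -> a <= t <= b -> g s = g t -> f s = f t.
Proof.
move=> fc abs abt gst; apply/eqP; rewrite -subr_eq0 -normr_le0.
apply/ler_addgt0Pr => e e0; rewrite add0r.
have [d d0 fd] := fc s abs e e0.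
by apply/ltW/fd => //; rewrite gst subrr normr0.
Qed.

Lemma gcontinuous_cvg_left a b g f t : gcontinuous a b g f ->
  g s @[s --> t^'-] --> g t -> a < t <= b -> f s @[s --> t^'-] --> f t.
Proof.
move=> fc gt abt; apply/cvgrPdist_lt => e e0.
have [d d0 fd] := fc t ltac:(lra) e e0.
near=> s; apply: fd.
- have st : s < t by near: s; exact: nbhs_left_lt.
  have as_ : a < s by near: s; apply: nbhs_left_gt; lra.
  by lra.
- by near: s; move/cvgrPdist_lt: gt; exact.
Unshelve. all: by end_near. Qed.

Lemma cvg_within_right (T : topologicalType) (A : set R) t (h : R -> T)
    (l : T) :
  h @ within A (nbhs t) --> l -> h @ within A t^'+ --> l.
Proof.
move=> hl; apply: cvg_trans hl => P.
by move=> nearP; exact: (@cvg_within _ (nbhs t)).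
Qed.

Lemma gderiv0_right_increment a b g f t e :
    derivator g -> gcontinuous a b g f -> 0 < e ->
    a <= t < b -> has_gderiv a b g f t 0 ->
  \forall s \near t^'+, `|f s - f t| <= e * (g s - g t).
Proof.
move=> [gmono _] fc e0 abt dft.
(* Where [g s = g t] the bound reduces to [f s = f t]. *)
suff : \forall s \near t^'+,
    g s != g t -> `|f s - f t| <= e * (g s - g t).
  move=> H; near=> s.
  have ts : t < s by near: s; exact: nbhs_right_gt.
  have sb : s < b by near: s; apply: nbhs_right_lt; lra.
  have [gst|gst] := eqVneq (g s) (g t).
    by rewrite gst (gcontinuous_eq fc _ _ gst) ?subrr ?normr0 ?mulr0 //; lra.
  by move: gst; near: s.
have quot0 : gquot g f t @ within (gadm a b g t) t^'+ --> 0 ->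
    \forall s \near t^'+, g s != g t -> `|f s - f t| <= e * (g s - g t).
  move=> /cvgrPdist_lt /(_ e e0); rewrite near_withinE => H.
  near=> s => gst.
  have ts : t < s by near: s; exact: nbhs_right_gt.
  have sb : s < b by near: s; apply: nbhs_right_lt; lra.
  have gpos : 0 < g s - g t.
    by rewrite subr_gt0 lt_neqAle eq_sym gst gmono // ltW.
  rewrite -ler_pdivrMr // -[X in _ / X]gtr0_norm // -normf_div.
  have : gadm a b g t s -> `|0 - gquot g f t s| < e by near: s.
  by rewrite sub0r normrN => H1; apply/ltW/H1; split=> //; lra.
case: dft => [[_ _ /cvg_within_right]|[_]|[u [y [[x Cx WE] uty _]]]];
  try exact: quot0.
(* In the remaining case the derivative is taken at [y], away from [t], but [g]
   is constant around [t]. *)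
have [d d0 [c gc]] : Cset g t.
  by apply: (@connected_component_sub _ _ x); rewrite WE.
near=> s => /eqP[].
have ts : t < s by near: s; exact: nbhs_right_gt.
have sd : s < t + d by near: s; apply: nbhs_right_lt; lra.
by rewrite !gc //; lra.
Unshelve. all: by end_near. Qed.

(** The mean value inequality relative to [g], with an arbitrarily small bound
    [e] on the derivative. *)
Lemma gderiv0_increment a b g f e :
    derivator g -> gcontinuous a b g f -> 0 < e ->
    (forall t, a <= t <= b -> has_gderiv a b g f t 0) ->
  forall t, a <= t <= b -> `|f t - f a| <= e * (g t - g a).
Proof.
move=> gd fc e0 df0; apply: segment_ind => [|t abt IH|t abt IH].
- by rewrite !subrr normr0 mulr0.
- have gt := gd.2 t.
  have ft := gcontinuous_cvg_left fc gt abt.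
  apply: (@ler_cvg_to _ (t^'-) _ _ (fun s => `|f s - f a|)
            (fun s => e * (g s - g a))).
  + by apply: cvg_norm; apply: cvgB => //; exact: cvg_cst.
  + by apply: cvgMr; apply: cvgB => //; exact: cvg_cst.
  + near=> s; apply: IH.
    have st : s < t by near: s; exact: nbhs_left_lt.
    have as_ : a < s by near: s; apply: nbhs_left_gt; lra.
    by lra.
- have := gderiv0_right_increment gd fc e0 abt (df0 t ltac:(lra)).
  apply: filterS => s fs.
  have := ler_distD (f t) (f s) (f a); lra.
Unshelve. all: by end_near. Qed.

Lemma gderiv_cst a b g f c t :
    ~ Cset g b -> (forall s, a <= s <= b -> f s = c) ->
    a <= t <= b -> has_gderiv a b g f t 0.
Proof.
move=> nCb fc abt.
have quot0 x : a <= x <= b -> forall F : set_system R, Filter F ->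
    gquot g f x @ within (gadm a b g x) F --> 0.
  move=> abx F FF; apply: cvg_near_cst.
  rewrite near_withinE; apply: nearW => s [abs _].
  by rewrite /gquot !fc // subrr mul0r.
have [Ct|nCt] := pselect (Cset g t).
  have tb : t < b.
    rewrite lt_neqAle; apply/andP; split; last by lra.
    by apply/eqP => tb; rewrite tb in Ct.
  have [u [y [Cuy uty yb]]] := Ccomponent_right_endpoint Ct tb nCb.
  apply: Or33; exists u, y; split => //; apply: quot0.
  by move: uty => /andP[_]; rewrite lte_fin; lra.
have [Dt|nDt] := pselect (Dset g t).
  by apply: Or32; split => //; exact: quot0.
by apply: Or31; split => //; exact: quot0.
Qed.

End Derivator.

Theorem theorem3p8 (R : realType) (a b : R) (g f : R -> R)
  (lt_ab : a < b)
  (g_derivator : derivator g)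
  (aN : ~ Nminus g a)
  (bN : ~ (Nplus g `|` Dset g `|` Cset g) b)
  (f_gcont : gcontinuous a b g f) :
  (forall t : R, a <= t <= b -> has_gderiv a b g f t 0) <->
  (exists c : R, forall t : R, a <= t <= b -> f t = c).
Proof.
split=> [df0|[c fc] t abt]; last first.
  by apply: (gderiv_cst _ fc) => // Cb; apply: bN; right.
exists (f a) => t abt; apply/eqP; rewrite -subr_eq0 -normr_le0.
apply/ler_addgt0Pr => e e0; rewrite add0r.
have gat : 0 <= g t - g a by rewrite subr_ge0 g_derivator.1 //; lra.
(* The factor [g t - g a + 1] is positive even when [g t = g a]. *)
have d0 : 0 < e / (g t - g a + 1) by rewrite divr_gt0 //; lra.
apply: le_trans (gderiv0_increment g_derivator f_gcont d0 df0 abt) _.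
by rewrite mulrAC ler_pdivrMr ?ler_wpM2l; lra.
Qed.
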